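(* Let $A$ and $B$ be abelian Lie algebras over a field $k$, so that $A$ is a vector space with linear basis $X=\{x_i\mid i\in I\}$ and $B$ is a vector space with linear basis $Y=\{y_j\mid j\in J\}$ over $k$. Let $A\ast B$ be the metabelian product of $A$ and $B$, and let $R_{X\cup Y}=k[X\cup Y]$. Then the $R_{X\cup Y}$-module $(A\ast B)^2$ is isomorphic to $M_0$, where $M_0$ is the ideal of $R_{X\cup Y}$ generated by $\{x_iy_j\mid i\in I,\ j\in J\}$, regarded as an $R_{X\cup Y}$-module.
   Context: A Lie algebra over $k$ is metabelian if $(a\circ b)\circ(c\circ d)=0$ for all $a,b,c,d$, where $\circ$ is the Lie product. The commutant $L^2$ of a Lie algebra $L$ is the ideal generated by all products $a\circ b$, $a,b\in L$. $\mathcal{A}^2$ is the variety of all metabelian Lie $k$-algebras. If $A=\langle z_i, i\in I_A\mid R_A\rangle$ and $B=\langle z_i, i\in I_B\mid R_B\rangle$ are presentations in $\mathcal{A}^2$ with $I_A\cap I_B=\emptyset$, the metabelian product $A\ast B$ is the algebra with presentation $\langle z_i, i\in I_A\cup I_B\mid R_A\cup R_B\rangle$ in $\mathcal{A}^2$ (i.e. the coproduct of $A$ and $B$ in $\mathcal{A}^2$). The set $X\cup Y$ (a disjoint union) is a linear basis of $(A\ast B)/(A\ast B)^2$, and $(A\ast B)^2$ is a module over the polynomial ring $R_{X\cup Y}$ via $u\cdot z=u\circ z$ for $u\in(A\ast B)^2$, $z\in X\cup Y$ (the actions commute since $A\ast B$ is metabelian). *)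

(* Defs.v *)
From HB Require Import structures.
From mathcomp Require Import all_boot all_order all_algebra.
From mathcomp Require Import finmap monalg.
From mathcomp Require Import boolp.

Set Implicit Arguments.
Unset Strict Implicit.
Unset Printing Implicit Defensive.

Import GRing.Theory.

Local Open Scope ring_scope.

HB.mixin Record Lmodule_isLieAlgebra (k : fieldType) L
    of GRing.Lmodule k L := {
  lie : L -> L -> L;
  lieDl : left_distributive lie +%R;
  lieDr : right_distributive lie +%R;
  lieZl : forall (c : k) a b, lie (c *: a) b = c *: lie a b;
  lieZr : forall (c : k) a b, lie a (c *: b) = c *: lie a b;
  liexx : forall a, lie a a = 0;
  jacobi : forall a b c,
    lie (lie a b) c + lie (lie b c) a + lie (lie c a) b = 0
}.

#[short(type="lieAlgType")]
HB.structure Definition LieAlgebra (k : fieldType) :=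
  { L of GRing.Lmodule k L & Lmodule_isLieAlgebra k L }.

Notation "a \o_L b" := (lie a b)
  (at level 40, left associativity, format "a  \o_L  b") : ring_scope.

HB.mixin Record LieAlgebra_isMetabelian (k : fieldType) L
    of LieAlgebra k L := {
  metabelian : forall a b c d : L, (a \o_L b) \o_L (c \o_L d) = 0
}.

#[short(type="metabLieType")]
HB.structure Definition MetabelianLie (k : fieldType) :=
  { L of LieAlgebra k L & LieAlgebra_isMetabelian k L }.

Definition abelian_lie (k : fieldType) (L : lieAlgType k) : Prop :=
  forall a b : L, a \o_L b = 0.

(* An indexed family is a basis; [I] may be infinite, so linear combinations *)
(* run over duplicate-free finite sequences of indices.                      *)
Definition is_basis (k : fieldType) (V : lmodType k) (I : choiceType)
    (x : I -> V) : Prop :=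
  (forall (s : seq I) (c : I -> k), uniq s ->
     \sum_(i <- s) c i *: x i = 0 -> {in s, forall i, c i = 0}) /\
  (forall v : V, exists (s : seq I) (c : I -> k),
     v = \sum_(i <- s) c i *: x i).

Definition lie_morphism (k : fieldType) (L M : lieAlgType k)
    (f : {linear L -> M}) : Prop :=
  forall a b : L, f (a \o_L b) = f a \o_L f b.

(* [P] with [iA], [iB] is the coproduct of [A] and [B] in the variety of     *)
(* metabelian Lie algebras; it is unique up to a unique isomorphism.         *)
Definition is_metabelian_product (k : fieldType) (A B : lieAlgType k)
    (P : metabLieType k) (iA : {linear A -> P}) (iB : {linear B -> P}) :
    Prop :=
  [/\ lie_morphism iA,
      lie_morphism iB &
      forall (L : metabLieType k) (f : {linear A -> L}) (g : {linear B -> L}),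
        lie_morphism f -> lie_morphism g ->
        exists h : {linear P -> L},
          [/\ lie_morphism h,
              forall a, h (iA a) = f a,
              forall b, h (iB b) = g b &
              forall h' : {linear P -> L}, lie_morphism h' ->
                (forall a, h' (iA a) = f a) -> (forall b, h' (iB b) = g b) ->
                h' =1 h]].

Section Commutant.
Context (k : fieldType) (L : lieAlgType k).

(* One-sided stability suffices, since the product is anticommutative. *)
Definition lie_ideal (S : {pred L}) : Prop :=
  submod_closed S /\ (forall u a : L, u \in S -> u \o_L a \in S).

Definition commutant : {pred L} := fun u =>
  `[< forall S : {pred L}, lie_ideal S ->
        (forall a b : L, a \o_L b \in S) -> u \in S >].

Lemma commutantP u :
  reflect (forall S : {pred L}, lie_ideal S ->
             (forall a b : L, a \o_L b \in S) -> u \in S)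
          (u \in commutant).
Proof. exact: asboolP. Qed.

Lemma lie_commutant a b : a \o_L b \in commutant.
Proof. by apply/commutantP => S _; apply. Qed.

Lemma commutant_submod_closed : submod_closed commutant.
Proof.
split=> [|c u v /commutantP uP /commutantP vP]; apply/commutantP => S idS S1.
  by case: idS => -[].
by have [[_ ->]] := idS; [| exact: uP | exact: vP].
Qed.

HB.instance Definition _ :=
  GRing.isSubmodClosed.Build k L commutant commutant_submod_closed.

Record commutant_type : Type :=
  CommutantType { commutant_val : L; _ : commutant_val \in commutant }.
HB.instance Definition _ := [isSub for commutant_val].
HB.instance Definition _ := [Choice of commutant_type by <:].
HB.instance Definition _ :=
  [SubChoice_isSubLmodule of commutant_type by <:].

Definition lie_commutant_r (z : L) (u : commutant_type) : commutant_type :=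
  CommutantType (lie_commutant (val u) z).

Lemma lie_commutant_r_linear z : linear (lie_commutant_r z).
Proof. by move=> c u v; apply: val_inj; rewrite /= lieDl lieZl. Qed.

End Commutant.

Lemma lie_commutant_rC (k : fieldType) (L : metabLieType k) (z w : L) u :
  lie_commutant_r z (lie_commutant_r w u)
  = lie_commutant_r w (lie_commutant_r z u).
Proof.
have lieN (a b : L) : a \o_L b = - (b \o_L a).
  apply/eqP; rewrite -addr_eq0.
  by have := liexx (a + b); rewrite lieDl !lieDr !liexx add0r addr0 => ->.
have uC (c d : L) : val u \o_L (c \o_L d) = 0.
  pose S : {pred L} := fun v => `[< forall c d : L, v \o_L (c \o_L d) = 0 >].
  suff /asboolP/(_ c d) : val u \in S by [].
  move: (valP u) => /commutantP; apply.
    split; first split.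
    - by apply/asboolP=> c' d'; rewrite -[X in X \o_L _](scale0r (0 : L)) lieZl scale0r.
    - move=> e a b /asboolP aS /asboolP bS; apply/asboolP=> c' d'.
      by rewrite lieDl lieZl aS bS scaler0 addr0.
    by move=> a b /asboolP aS; apply/asboolP=> c' d'; rewrite metabelian.
  by move=> a b; apply/asboolP=> c' d'; rewrite metabelian.
apply: val_inj => /=.
have := jacobi (val u) w z.
rewrite [(w \o_L z) \o_L _]lieN uC oppr0 addr0 [z \o_L _]lieN => /eqP.
by rewrite -[- _]scaleN1r lieZl scaleN1r subr_eq0 => /eqP.
Qed.

(* k[V], with a possibly infinite set of variables V *)
Notation polyring k V := {malg k[{cmonom V}]}.
Notation polyvar v := (<< ucm v >> : polyring _ _).

(* The action on L^2 of the polynomial ring k[V], where the variable v acts  *)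
(* as u |-> u \o_L z v.                                                      *)
Section PolyAction.
Context (k : fieldType) (L : metabLieType k) (V : choiceType) (z : V -> L).

Definition mon_action (m : {cmonom V}) (u : commutant_type L) :
    commutant_type L :=
  foldr (fun v w => iter (m v) (lie_commutant_r (z v)) w) u (finsupp m).

Definition poly_action (p : polyring k V) (u : commutant_type L) :
    commutant_type L :=
  \sum_(m <- msupp p) p@_m *: mon_action m u.

Let actn (m : {cmonom V}) (s : seq V) (u : commutant_type L) :=
  foldr (fun v w => iter (m v) (lie_commutant_r (z v)) w) u s.

Lemma iter_lie_linear n v : linear (iter n (lie_commutant_r (z v))).
Proof.
by elim: n => [//|n IHn] c u w; rewrite !iterS IHn lie_commutant_r_linear.
Qed.

Lemma iter_lieC n1 n2 v w u :
  iter n1 (lie_commutant_r (z v)) (iter n2 (lie_commutant_r (z w)) u)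
  = iter n2 (lie_commutant_r (z w)) (iter n1 (lie_commutant_r (z v)) u).
Proof.
have lieC x : lie_commutant_r (z v) (iter n2 (lie_commutant_r (z w)) x)
    = iter n2 (lie_commutant_r (z w)) (lie_commutant_r (z v) x).
  by elim: n2 => [//|n IHn]; rewrite !iterS -IHn lie_commutant_rC.
by elim: n1 => [//|n IHn]; rewrite !iterS IHn lieC.
Qed.

Lemma actn_iter m s n v u :
  actn m s (iter n (lie_commutant_r (z v)) u)
  = iter n (lie_commutant_r (z v)) (actn m s u).
Proof. by elim: s => [//|w s IHs] /=; rewrite IHs iter_lieC. Qed.

Lemma actnM m1 m2 s u : actn (mmul m1 m2) s u = actn m1 s (actn m2 s u).
Proof.
elim: s => [//|v s IHs] /=.
by rewrite IHs cmM iterD actn_iter.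
Qed.

Lemma actn_linear m s : linear (actn m s).
Proof. by elim: s => [//|v s IHs] c u w /=; rewrite IHs iter_lie_linear. Qed.

Lemma actnC m n s t u : actn m s (actn n t u) = actn n t (actn m s u).
Proof. by elim: t => [//|v t IHt] /=; rewrite actn_iter IHt. Qed.

Lemma perm_actn m s t u : perm_eq s t -> actn m s u = actn m t u.
Proof.
apply: (catCA_perm_subst (F := fun s => actn m s u)) => s1 s2 s3.
by rewrite /actn !foldr_cat; exact: actnC.
Qed.

Lemma mon_actionEw (m : {cmonom V}) s u : uniq s -> {subset finsupp m <= s} ->
  mon_action m u = actn m s u.
Proof.
move=> s_uniq ms.
rewrite -(perm_actn m u (introT permPl (perm_filterC (mem (finsupp m)) s))).
rewrite /actn foldr_cat [X in foldr _ X]/=.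
have -> : foldr (fun v w => iter (m v) (lie_commutant_r (z v)) w) u
    [seq x <- s | predC (mem (finsupp m)) x] = u.
  elim: s {s_uniq ms} => [//|v s IHs] /=.
  by case: ifP => //= vm; rewrite IHs (eqP (_ : m v == 0%N)) // cmE_eq0.
apply: perm_actn; apply: uniq_perm; rewrite ?fset_uniq ?filter_uniq // => v.
by rewrite mem_filter /=; apply/idP/andP => [vm|[]//]; split=> //; apply: ms.
Qed.

Lemma mon_action_linear m : linear (mon_action m).
Proof. exact: actn_linear. Qed.

HB.instance Definition _ m :=
  GRing.isLinear.Build k (commutant_type L) (commutant_type L) _
    (mon_action m) (mon_action_linear m).

Lemma mon_action1 u : mon_action (mone : {cmonom V}) u = u.
Proof. by rewrite /mon_action mdom1. Qed.

Lemma mon_actionU v u : mon_action (ucm v) u = lie_commutant_r (z v) u.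
Proof.
rewrite (@mon_actionEw _ [:: v]) //= ?cmUU // => w.
by rewrite mdomU inE mem_seq1.
Qed.

Lemma mon_actionM m1 m2 u :
  mon_action (mmul m1 m2) u = mon_action m1 (mon_action m2 u).
Proof.
pose s : seq V := finsupp (mmul m1 m2).
have s_uniq : uniq s by exact: fset_uniq.
rewrite !(@mon_actionEw _ s) ?actnM // => v; rewrite /s mdomD inE => ->//.
by rewrite orbT.
Qed.

Lemma poly_actionEw (d : {fset {cmonom V}}) p u : (msupp p `<=` d)%fset ->
  poly_action p u = \sum_(m <- d) p@_m *: mon_action m u.
Proof.
move=> pd; rewrite /poly_action (big_fset_incl _ pd) // => m _ mp.
by rewrite mcoeff_outdom ?scale0r.
Qed.

Lemma poly_actionU c m u : poly_action << c *g m >> u = c *: mon_action m u.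
Proof.
by rewrite (poly_actionEw _ msuppU_le) big_seq_fset1 mcoeffUU.
Qed.

Lemma poly_actionDl u : {morph poly_action^~ u : p q / p + q}.
Proof.
move=> p q /=; set d := (msupp p `|` msupp q)%fset.
rewrite !(@poly_actionEw d) ?fsubsetUl ?fsubsetUr ?msuppD_le // -big_split.
by apply: eq_bigr => m _; rewrite mcoeffD scalerDl.
Qed.

Lemma poly_actionDr p : {morph poly_action p : u w / u + w}.
Proof.
move=> u w; rewrite -big_split.
by apply: eq_bigr => m _; rewrite raddfD scalerDr.
Qed.

Lemma poly_action1 u : poly_action 1 u = u.
Proof. by rewrite poly_actionU mon_action1 scale1r. Qed.

Lemma poly_action0l u : poly_action 0 u = 0.
Proof. by rewrite /poly_action msupp0 big_seq_fset0. Qed.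

Lemma poly_actionA p q u :
  poly_action p (poly_action q u) = poly_action (p * q) u.
Proof.
have sumE (I : Type) (r : seq I) (F : I -> polyring k V) w :
    poly_action (\sum_(i <- r) F i) w = \sum_(i <- r) poly_action (F i) w.
  exact: (big_morph _ (poly_actionDl w) (poly_action0l w)).
transitivity (\sum_(m <- msupp p) \sum_(n <- msupp q)
    poly_action << p@_m * q@_n *g mmul m n >> u); last first.
  rewrite [in RHS]malgME sumE; apply: eq_bigr => m _.
  by rewrite sumE.
rewrite {1}/poly_action; apply: eq_bigr => m _.
rewrite {1}/poly_action raddf_sum scaler_sumr; apply: eq_bigr => n _.
by rewrite poly_actionU mon_actionM -scalerA; congr (_ *: _); exact: linearZ.
Qed.

End PolyAction.

(* L^2 as a k[V]-module for the action above; the alias records [z]. *)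
Definition commutant_module (k : fieldType) (L : metabLieType k)
    (V : choiceType) (z : V -> L) : Type := commutant_type L.

Section CommutantModule.
Context (k : fieldType) (L : metabLieType k) (V : choiceType) (z : V -> L).

HB.instance Definition _ :=
  GRing.Zmodule.copy (commutant_module z) (commutant_type L).
HB.instance Definition _ :=
  GRing.Zmodule_isLmodule.Build (polyring k V) (commutant_module z)
    (@poly_actionA k L V z) (@poly_action1 k L V z)
    (@poly_actionDr k L V z) (@poly_actionDl k L V z).

Lemma commutant_module_scaleX v (u : commutant_module z) :
  commutant_val (polyvar v *: u) = commutant_val u \o_L z v.
Proof.
rewrite [_ *: u](_ : _ = lie_commutant_r (z v) u) //.
by rewrite [LHS]poly_actionU scale1r mon_actionU.
Qed.

Lemma commutant_module_scaleC (c : k) (u : commutant_module z) :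
  commutant_val ((c%:MP : polyring k V) *: u) = c *: commutant_val u.
Proof.
by rewrite [_ *: u]poly_actionU mon_action1.
Qed.

End CommutantModule.

Section IdealM0.
Context (k : fieldType) (I J : choiceType).
Let R := polyring k (I + J)%type.

(* The ideals of a commutative ring [R] are the submodules of [R^o]. *)
Definition M0 : {pred R^o} := fun p =>
  `[< forall S : {pred R^o}, submod_closed S ->
        (forall i j, (polyvar (inl i) * polyvar (inr j) : R) \in S) ->
        p \in S >].

Lemma M0P p :
  reflect (forall S : {pred R^o}, submod_closed S ->
             (forall i j, (polyvar (inl i) * polyvar (inr j) : R) \in S) ->
             p \in S)
          (p \in M0).
Proof. exact: asboolP. Qed.

Lemma M0_submod_closed : submod_closed M0.
Proof.
split=> [|c u v /M0P uP /M0P vP]; apply/M0P => S clS S1; first by case: clS.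
by case: (clS) => _ ->; [|exact: uP|exact: vP].
Qed.

HB.instance Definition _ :=
  GRing.isSubmodClosed.Build R R^o M0 M0_submod_closed.

Record M0_type : Type := M0Type { M0_val : R^o; _ : M0_val \in M0 }.
HB.instance Definition _ := [isSub for M0_val].
HB.instance Definition _ := [Choice of M0_type by <:].
HB.instance Definition _ := [SubChoice_isSubLmodule of M0_type by <:].

End IdealM0.

(* The disjoint union X u Y, seen inside the product through iA and iB *)
Definition joint_family (A B P I J : Type) (iA : A -> P) (iB : B -> P)
    (x : I -> A) (y : J -> B) (v : I + J) : P :=
  match v with inl i => iA (x i) | inr j => iB (y j) end.

(* Main.v *)
Require Import Defs.
From HB Require Import structures.
From mathcomp Require Import all_boot all_order all_algebra.
From mathcomp Require Import finmap monalg.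
From mathcomp Require Import boolp zify ring.

Set Implicit Arguments.
Unset Strict Implicit.
Unset Printing Implicit Defensive.

Import GRing.Theory.

Local Open Scope ring_scope.

(** Write [z v] for the image in [P] of the basis element indexed by [v], and
[X v] for the corresponding variable of the polynomial ring [R].  The module
[P^2] should be generated by the products [z i o z j], with [i] indexing [A]
and [j] indexing [B], and [z i o z j] should go to [X i * X j].  The proof
compares [P] with an explicit metabelian Lie algebra in which this is visible.

Extend the variables to linear maps [alpha : A -> R] and [beta : B -> R].  On
[A x B x M0] put the bracket
  [(a,b,p) o (a',b',p') = (0, 0, alpha a * beta b' - alpha a' * beta b
                                 + p * (alpha a' + beta b')
                                 - p' * (alpha a + beta b))];
here [(a,b)] acts on [M0] as multiplication by [alpha a + beta b], and the
first two terms form a 2-cocycle, because a determinant with rows [alpha],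
[beta] and [alpha + beta] vanishes.  This is the algebra [model].  As [A]
and [B] embed in it as abelian subalgebras, the universal property of [P]
gives a morphism [h : P -> model] ([transfer] is its last component on [P^2]).

A map back, [model_eval : model -> P], needs a linear map [psi] on [R] with
[psi (X i * X j) = z i o z j], compatible with the action of [R] on [M0]
([ideal_eval]).  It is defined on monomials: [X i * X j * n] must go to
[n] acting on [z i o z j], and the content is that the result depends on the
monomial only ([mixed_wd]).  This follows from the Jacobi identity, which for
commuting [z i] and [z i'] gives [(z i o z j) o z i' = (z i' o z j) o z i],
and likewise in the second index.

By the uniqueness part of the universal property the composite
[P -> model -> P] is the identity.  On [P^2] the first two components of [h]
vanish, so [psi] is a left inverse of [transfer], which is thus injective.
It is [R]-linear ([transfer_action]), and its image is an ideal that contains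
the generators [X i * X j] of [M0] ([transfer_surj]), so it is onto [M0]. *)

(** * Linear maps determined by their values on a basis *)

Section MalgLift.
Context (k : fieldType) (K : choiceType) (W : lmodType k) (w : K -> W).

Definition malg_lift (g : {malg k[K]}) : W := \sum_(m <- msupp g) g@_m *: w m.

Lemma malg_liftEw (d : {fset K}) g : (msupp g `<=` d)%fset ->
  malg_lift g = \sum_(m <- d) g@_m *: w m.
Proof.
move=> gd; rewrite /malg_lift (big_fset_incl _ gd) // => m _ mg.
by rewrite mcoeff_outdom ?scale0r.
Qed.

Lemma malg_lift_is_linear : linear malg_lift.
Proof.
move=> c f g; pose d := (msupp f `|` msupp g)%fset.
have fd : (msupp f `<=` d)%fset by exact: fsubsetUl.
have gd : (msupp g `<=` d)%fset by exact: fsubsetUr.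
have sd : (msupp (c *: f + g) `<=` d)%fset.
  by apply: fsubset_trans (msuppD_le _ _) _; apply: fsetSU; exact: msuppZ_le.
rewrite (malg_liftEw fd) (malg_liftEw gd) (malg_liftEw sd) scaler_sumr.
rewrite -big_split; apply: eq_bigr => m _ /=.
by rewrite mcoeffD mcoeffZ scalerDl scalerA.
Qed.

HB.instance Definition _ :=
  GRing.isLinear.Build k {malg k[K]} W _ malg_lift malg_lift_is_linear.

Lemma malg_liftU c m : malg_lift << c *g m >> = c *: w m.
Proof. by rewrite (malg_liftEw msuppU_le) big_seq_fset1 mcoeffUU. Qed.

End MalgLift.

Section Basis.
Context (k : fieldType) (V : lmodType k) (I : choiceType) (x : I -> V).
Hypothesis basis_x : is_basis x.

Lemma basis_ind (Q : V -> Prop) :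
  Q 0 -> (forall c i v, Q v -> Q (c *: x i + v)) -> forall v, Q v.
Proof.
move=> Q0 QD v; have [s [c ->]] := basis_x.2 v.
by elim: s => [|i s IHs]; rewrite ?big_nil // big_cons; apply: QD.
Qed.

(** A basis identifies [V] with the free module [{malg k[I]}]: [malg_lift x] is
bijective, and its inverse reads off coordinates. *)
Lemma basis_lift (W : lmodType k) (w : I -> W) :
  exists f : {linear V -> W}, forall i, f (x i) = w i.
Proof.
have ex_coord v : exists g : {malg k[I]}, malg_lift x g = v.
  elim/basis_ind: v => [|c i v [g <-]]; first by exists 0; rewrite linear0.
  by exists (<< c *g i >> + g); rewrite linearD /= malg_liftU.
have [coord coordK] := choice ex_coord.
have lift_inj : injective (malg_lift x).
  move=> g h /eqP; rewrite -subr_eq0 -linearB => /eqP gh0.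
  apply/eqP; rewrite -subr_eq0; apply/eqP/malgP => i; rewrite mcoeff0.
  have [mi|mi] := boolP (i \in msupp (g - h)); last exact: mcoeff_outdom.
  exact: (basis_x.1 (msupp (g - h)) (mcoeff^~ (g - h)) (fset_uniq _) gh0).
have coord_lin : linear coord.
  by move=> c u v; apply: lift_inj; rewrite coordK linearP /= !coordK.
pose coordL : {linear V -> {malg k[I]}} :=
  HB.pack coord (GRing.isLinear.Build k V {malg k[I]} _ coord coord_lin).
exists (malg_lift w \o coordL) => i /=.
rewrite (_ : coord (x i) = << 1 *g i >>) ?malg_liftU ?scale1r //.
by apply: lift_inj; rewrite coordK malg_liftU scale1r.
Qed.

End Basis.

(** * Monomials and polynomials *)

Section Polynomials.
Context (k : fieldType) (V : choiceType).
Implicit Types (m : {cmonom V}) (v : V).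

Lemma cmonom_factor m v : m v != 0%N -> exists n, m = mmul (ucm v) n.
Proof.
move=> mv; exists (divcm m (ucm v)); apply/eqP/cmP => w.
rewrite cmM divcmE cmU; have [<-|_] := eqVneq v w; last by rewrite subn0.
by rewrite subnKC ?lt0n.
Qed.

Lemma cmonom_ind (Q : {cmonom V} -> Prop) :
  Q mone -> (forall v m, Q m -> Q (mmul (ucm v) m)) -> forall m, Q m.
Proof.
move=> Q1 QM m; have [n] := ubnP (mdeg m).
elim: n m => [m|n IHn m]; first by rewrite ltn0.
have [/mdeg_eq0I -> _|] := posnP (mdeg m); first exact: Q1.
rewrite lt0n mdeg_eq0 => m1.
have [v mv] : exists v, m v != 0%N.
  apply: contrapT => /forallNP m0; case/negP: m1; apply/cmP => v.
  by rewrite cm1; apply/eqP; have /negP := m0 v; rewrite negbK.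
have [n' ->] := cmonom_factor mv; rewrite mdegM mdegU => lt_n'n.
by apply/QM/IHn.
Qed.

Lemma cmonom_mulI m : injective (mmul m).
Proof.
move=> n1 n2 /eqP/cmP e; apply/eqP/cmP => v; apply/eqP.
by rewrite -(eqn_add2l (m v)) -!cmM e.
Qed.

Lemma malgMU (c : k) m n :
  << c *g m >> * << n >> = << c *g mmul m n >> :> polyring k V.
Proof. by rewrite malgM_def fgmulUU mulr1. Qed.

Lemma polyring_ind (Q : polyring k V -> Prop) :
  Q 1 -> (forall v p, Q p -> Q (polyvar v * p)) ->
  (forall c p q, Q p -> Q q -> Q (c *: p + q)) -> forall p, Q p.
Proof.
move=> Q1 QX QD p.
have Q0 : Q 0 by have := QD (-1) 1 1 Q1 Q1; rewrite scaleN1r addNr.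
have Qm m : Q << m >>.
  by elim/cmonom_ind: m => [//|v m /(QX v)]; rewrite malgMU.
rewrite (monalgE p); elim: (finsupp _ : seq _) => [|m s IHs].
  by rewrite big_nil.
rewrite big_cons (_ : << _ *g m >> = p@_m *: << m >>).
  exact: (QD _ _ _ (Qm m) IHs).
by rewrite -mul_malgC malgMU mul1m.
Qed.

End Polynomials.

(** * A metabelian Lie algebra on A x B x M0 *)

Section Model.
Context (k : fieldType) (I J : choiceType).
Local Notation R := (polyring k (I + J)%type).
Context (A B : lmodType k) (alpha : {linear A -> R}) (beta : {linear B -> R}).

Lemma M0Z (c : k) (p : R) : p \in @M0 k I J -> c *: p \in @M0 k I J.
Proof. by move=> pM; rewrite -mul_malgC; exact: (@rpredZ R R^o). Qed.

Lemma M0Mr (p q : R) : p \in @M0 k I J -> p * q \in @M0 k I J.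
Proof. by move=> pM; rewrite mulrC; exact: (@rpredZ R R^o). Qed.

Definition in_model : {pred A * B * R} := fun u => u.2 \in @M0 k I J.

Lemma in_model_submod : submod_closed in_model.
Proof.
split=> [|c u v uM vM]; rewrite unfold_in /=; first exact: (@rpred0 _ (@M0 k I J)).
by apply: (@rpredD _ (@M0 k I J)) => //; exact: M0Z.
Qed.

HB.instance Definition _ :=
  GRing.isSubmodClosed.Build k (A * B * R)%type in_model in_model_submod.

(** The argument [ab], which makes the bracket land in [M0], is recorded in the
type so that the Lie structure on [model ab] can be inferred from it. *)
Record model (ab : forall a b, alpha a * beta b \in @M0 k I J) : Type :=
  Model { model_val : A * B * R; _ : model_val \in in_model }.

Section LieModel.
Variable ab : forall a b, alpha a * beta b \in @M0 k I J.
Local Notation Q := (model ab).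

HB.instance Definition _ := [isSub for @model_val ab].
HB.instance Definition _ := [Choice of Q by <:].
HB.instance Definition _ := [SubChoice_isSubLmodule of Q by <:].

(** The polynomial by which [u] acts on the [M0] component. *)
Definition weight (u : Q) : R := alpha (val u).1.1 + beta (val u).1.2.

Definition model_bracket (u v : Q) : R :=
  alpha (val u).1.1 * beta (val v).1.2 - alpha (val v).1.1 * beta (val u).1.2
  + ((val u).2 * weight v - (val v).2 * weight u).

Lemma model_bracket_in u v : (0, 0, model_bracket u v) \in in_model.
Proof.
have mB (p q : R) : p \in @M0 k I J -> q \in @M0 k I J -> p - q \in @M0 k I J.
  exact: (@rpredB _ (@M0 k I J)).
rewrite unfold_in /=; apply: (@rpredD _ (@M0 k I J)).
  by apply: mB; exact: ab.
by apply: mB; apply: M0Mr; [exact: (valP u)|exact: (valP v)].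
Qed.

Definition model_lie (u v : Q) : Q := Model ab (model_bracket_in u v).

Let top (p : R) : A * B * R := (0, 0, p).

Let topP c p q : top (c%:MP * p + q) = c *: top p + top q.
Proof.
rewrite -[RHS]/(c *: 0 + 0, c *: 0 + 0, c *: p + q).
by rewrite !scaler0 !addr0 mul_malgC.
Qed.

Let weightP c u v : weight (c *: u + v) = c%:MP * weight u + weight v.
Proof. by rewrite /weight !linearP /= !mul_malgC scalerDr addrACA. Qed.

Let bracketC u v : model_bracket u v = - model_bracket v u.
Proof. by rewrite /model_bracket; ring. Qed.

Let bracketP c u v w : model_bracket (c *: u + v) w
  = c%:MP * model_bracket u w + model_bracket v w.
Proof.
rewrite /model_bracket weightP !linearP /= -!mul_malgC; ring.
Qed.

Let model_lieP c u v w : model_lie (c *: u + v) w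
  = c *: model_lie u w + model_lie v w.
Proof. by apply: val_inj; rewrite linearP /= -topP -bracketP. Qed.

Let model_lieC u v : model_lie u v = - model_lie v u.
Proof.
apply: val_inj; rewrite linearN /= /model_lie /= bracketC.
by rewrite -[RHS]/(- 0, - 0, - model_bracket v u) !oppr0.
Qed.

Lemma model_lieDl : left_distributive model_lie +%R.
Proof. by move=> u v w; rewrite -[u]scale1r model_lieP !scale1r. Qed.

Lemma model_lieDr : right_distributive model_lie +%R.
Proof.
by move=> u v w; rewrite model_lieC model_lieDl opprD -!(model_lieC u).
Qed.

Lemma model_lieZl c u v : model_lie (c *: u) v = c *: model_lie u v.
Proof.
have lie0 : model_lie 0 v = 0.
  by have := model_lieP (-1) 0 0 v; rewrite scaler0 addr0 scaleN1r addNr.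
by rewrite -[c *: u]addr0 model_lieP lie0 addr0.
Qed.

Lemma model_lieZr c u v : model_lie u (c *: v) = c *: model_lie u v.
Proof. by rewrite model_lieC model_lieZl (model_lieC u) scalerN. Qed.

Lemma model_liexx u : model_lie u u = 0.
Proof.
apply: val_inj; rewrite linear0 /=; congr (_, _); rewrite /model_bracket; ring.
Qed.

Let weight_lie u v : weight (model_lie u v) = 0.
Proof. by rewrite /weight /= !linear0 addr0. Qed.

(** A double bracket only has an [M0] component, so the claim is a polynomial
identity in the coordinates.  Its cubic part is the vanishing of the determinant
with rows [alpha], [beta] and [alpha + beta]; the rest is commutativity. *)
Lemma model_jacobi u v w : model_lie (model_lie u v) w
  + model_lie (model_lie v w) u + model_lie (model_lie w u) v = 0.
Proof.
apply: val_inj; rewrite !linearD linear0 /=.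
set p := model_bracket _ w; set q := model_bracket _ u.
set r := model_bracket _ v.
rewrite -[LHS]/(0 + 0 + 0, 0 + 0 + 0, p + q + r) !addr0; congr (_, _).
rewrite /p /q /r {p q r} /model_bracket !weight_lie /= !linear0 /weight.
rewrite /model_bracket /weight; ring.
Qed.

Lemma model_metabelian t u v w :
  model_lie (model_lie t u) (model_lie v w) = 0.
Proof.
apply: val_inj; rewrite linear0 /=; congr (_, _).
rewrite /model_bracket !weight_lie /= !linear0.
by move: (model_bracket t u) (model_bracket v w) => p q; ring.
Qed.

HB.instance Definition _ := Lmodule_isLieAlgebra.Build k Q model_lieDl
  model_lieDr model_lieZl model_lieZr model_liexx model_jacobi.

HB.instance Definition _ := LieAlgebra_isMetabelian.Build k Q model_metabelian.

Lemma in_model0 (v : A * B) : (v, 0) \in in_model.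
Proof. exact: (@rpred0 _ (@M0 k I J)). Qed.

Definition model_inl (a : A) : Q := Model ab (in_model0 (a, 0)).
Definition model_inr (b : B) : Q := Model ab (in_model0 (0, b)).

Let in_modelP c (v w : A * B) :
  (c *: v + w, 0) = c *: (v, 0) + (w, 0) :> A * B * R.
Proof. by rewrite -[RHS]/(c *: v + w, c *: 0 + 0) scaler0 addr0. Qed.

Lemma model_inl_linear : linear model_inl.
Proof.
move=> c a a'; apply: val_inj; rewrite linearP /= -in_modelP; congr (_, _).
by rewrite -[RHS]/(c *: a + a', c *: 0 + 0) scaler0 addr0.
Qed.

Lemma model_inr_linear : linear model_inr.
Proof.
move=> c b b'; apply: val_inj; rewrite linearP /= -in_modelP; congr (_, _).
by rewrite -[RHS]/(c *: 0 + 0, c *: b + b') scaler0 addr0.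
Qed.

HB.instance Definition _ :=
  GRing.isLinear.Build k A Q _ model_inl model_inl_linear.
HB.instance Definition _ :=
  GRing.isLinear.Build k B Q _ model_inr model_inr_linear.

Lemma model_inl_lie a a' : model_inl a \o_L model_inl a' = 0.
Proof.
apply: val_inj; rewrite linear0 /=; congr (_, _).
by rewrite /model_bracket /= !linear0; ring.
Qed.

Lemma model_inr_lie b b' : model_inr b \o_L model_inr b' = 0.
Proof.
apply: val_inj; rewrite linear0 /=; congr (_, _).
by rewrite /model_bracket /= !linear0; ring.
Qed.

Lemma model_lie2 (u v : Q) : (val (u \o_L v)).2 = model_bracket u v.
Proof. by []. Qed.

Lemma model_lie_inl_inr a b :
  (val (model_inl a \o_L model_inr b)).2 = alpha a * beta b.
Proof. by rewrite model_lie2 /model_bracket /= !linear0; ring. Qed.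

(** Over the ideal [0 x 0 x M0], bracketing is multiplication by the weight; this
is what makes the comparison map linear over polynomials. *)
Lemma model_lie_top (u v : Q) : (val u).1 = 0 ->
  (val (u \o_L v)).2 = (val u).2 * weight v.
Proof.
move=> u0; rewrite model_lie2 /model_bracket /weight u0 /= !linear0; ring.
Qed.

Lemma weight_inl a : weight (model_inl a) = alpha a.
Proof. by rewrite /weight /= linear0 addr0. Qed.

Lemma weight_inr b : weight (model_inr b) = beta b.
Proof. by rewrite /weight /= linear0 add0r. Qed.

End LieModel.
End Model.

(** * Computing in Lie algebras and their commutants *)

Lemma lieC (k : fieldType) (L : lieAlgType k) (a b : L) :
  a \o_L b = - (b \o_L a).
Proof.
apply/eqP; rewrite -addr_eq0.
by have := liexx (a + b); rewrite lieDl !lieDr !liexx add0r addr0 => ->.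
Qed.

Lemma lie0l (k : fieldType) (L : lieAlgType k) (a : L) : 0 \o_L a = 0.
Proof. by have := lieZl 0 0 a; rewrite !scale0r. Qed.

Lemma lie0r (k : fieldType) (L : lieAlgType k) (a : L) : a \o_L 0 = 0.
Proof. by rewrite lieC lie0l oppr0. Qed.

(** The defining identity only says that products of generators of the commutant
vanish; it extends to the generated ideal in one argument at a time. *)
Lemma commutant_lie0 (k : fieldType) (L : metabLieType k) (u v : L) :
  u \in @commutant k L -> v \in @commutant k L -> u \o_L v = 0.
Proof.
move=> uL vL; pose S : {pred L} := fun w => `[< u \o_L w = 0 >].
suff /asboolP : v \in S by [].
have uS a b : u \o_L (a \o_L b) = 0.
  pose T : {pred L} := fun w => `[< w \o_L (a \o_L b) = 0 >].
  suff /asboolP : u \in T by [].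
  move: uL => /commutantP; apply; [split; first split|].
  - by apply/asboolP; rewrite lie0l.
  - move=> c w w' /asboolP wT /asboolP wT'; apply/asboolP.
    by rewrite lieDl lieZl wT wT' scaler0 addr0.
  - by move=> w w' _; apply/asboolP; rewrite metabelian.
  - by move=> w w'; apply/asboolP; rewrite metabelian.
move: vL => /commutantP; apply; [split; first split|].
- by apply/asboolP; rewrite lie0r.
- move=> c w w' /asboolP wT /asboolP wT'; apply/asboolP.
  by rewrite lieDr lieZr wT wT' scaler0 addr0.
- by move=> w w' _; apply/asboolP.
- by move=> w w'; apply/asboolP.
Qed.

(** Applied with summands in the images of [A] and [B] and in the commutant: the
right-hand side is then the shape that [model_eval] gives to [model_bracket]. *)
Lemma lie_expand (k : fieldType) (L : lieAlgType k) (a b s a' b' s' : L) :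
  a \o_L a' = 0 -> b \o_L b' = 0 -> s \o_L s' = 0 ->
  (a + b + s) \o_L (a' + b' + s')
  = a \o_L b' - a' \o_L b + (s \o_L (a' + b') - s' \o_L (a + b)).
Proof.
move=> aa bb ss; rewrite lieDl (lieDr _ _ s') [s \o_L _]lieDr ss addr0.
rewrite -addrA [_ + s \o_L _]addrC (lieC s' (a + b)) opprK; congr (_ + _).
by rewrite lieDl !lieDr aa bb addr0 add0r (lieC a' b) opprK.
Qed.

Lemma poly_actionZ (k : fieldType) (L : metabLieType k) (V : choiceType)
    (z : V -> L) (c : k) p u :
  poly_action z (c *: p) u = c *: poly_action z p u.
Proof. by rewrite -mul_malgC -poly_actionA poly_actionU mon_action1. Qed.

Lemma poly_actionX (k : fieldType) (L : metabLieType k) (V : choiceType)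
    (z : V -> L) v u : poly_action z (polyvar v) u = lie_commutant_r (z v) u.
Proof. by rewrite poly_actionU mon_actionU scale1r. Qed.

(** * Evaluating the ideal M0 in the commutant *)

(** With closure under sums, this makes the elements at which [f] is compatible
with the action an ideal, so that the minimality of [M0] applies to them. *)
Lemma equivariant_at_mull (R : pzRingType) (W : Type) (f : R -> W)
    (act : R -> W -> W) :
  (forall p q u, act p (act q u) = act (p * q) u) ->
  forall c p, (forall q, f (q * p) = act q (f p)) ->
  forall q, f (q * (c * p)) = act q (f (c * p)).
Proof. by move=> actA c p fp q; rewrite mulrA !fp actA. Qed.

Section Presentation.
Context (k : fieldType) (L : metabLieType k) (I J : choiceType).
Context (z : I + J -> L).
Hypothesis lie_inl : forall i i', z (inl i) \o_L z (inl i') = 0.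
Hypothesis lie_inr : forall j j', z (inr j) \o_L z (inr j') = 0.
Local Notation R := (polyring k (I + J)%type).
Implicit Types (m n : {cmonom (I + J)%type}) (i : I) (j : J).

Definition mixed_lie i j : commutant_type L :=
  CommutantType (lie_commutant (z (inl i)) (z (inr j))).

(** Jacobi, in which the term with [z (inl i) \o_L z (inl i')] vanishes. *)
Lemma mixed_lie_swapl i i' j :
  lie_commutant_r (z (inl i')) (mixed_lie i j)
  = lie_commutant_r (z (inl i)) (mixed_lie i' j).
Proof.
apply: val_inj; have /eqP := jacobi (z (inl i)) (z (inr j)) (z (inl i')).
by rewrite lie_inl lie0l addr0 (lieC (z (inr j))) -scaleN1r lieZl scaleN1r
  subr_eq0 => /eqP.
Qed.

Lemma mixed_lie_swapr i j j' :
  lie_commutant_r (z (inr j')) (mixed_lie i j)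
  = lie_commutant_r (z (inr j)) (mixed_lie i j').
Proof.
apply: val_inj; have /eqP := jacobi (z (inl i)) (z (inr j)) (z (inr j')).
by rewrite lie_inr lie0l addr0 (lieC (z (inr j'))) -scaleN1r lieZl scaleN1r
  subr_eq0 => /eqP.
Qed.

Local Notation act := (mon_action z).
Local Notation mixed i j n := (mmul (ucm (inl i)) (mmul (ucm (inr j)) n)).

(** If [X i'] divides [X i * X j * n] and [i'] differs from [i], then it divides
[n], so the roles of [i] and [i'] can be exchanged by [mixed_lie_swapl]. *)
Lemma mixed_changel i i' j n : mixed i j n (inl i') != 0%N ->
  exists2 n', mixed i j n = mixed i' j n' &
    act n (mixed_lie i j) = act n' (mixed_lie i' j).
Proof.
have [<- _|ii'] := eqVneq i i'; first by exists n.
rewrite !cmM !cmU !(inj_eq inl_inj) (negPf ii') !add0n.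
case/cmonom_factor => n' ->; exists (mmul (ucm (inl i)) n').
  apply/eqP/cmP => v; rewrite !cmM; lia.
by rewrite !(mulmC (ucm _)) !mon_actionM !mon_actionU mixed_lie_swapl.
Qed.

Lemma mixed_changer i j j' n : mixed i j n (inr j') != 0%N ->
  exists2 n', mixed i j n = mixed i j' n' &
    act n (mixed_lie i j) = act n' (mixed_lie i j').
Proof.
have [<- _|jj'] := eqVneq j j'; first by exists n.
rewrite !cmM !cmU !(inj_eq inr_inj) (negPf jj') !add0n.
case/cmonom_factor => n' ->; exists (mmul (ucm (inr j)) n').
  apply/eqP/cmP => v; rewrite !cmM; lia.
by rewrite !(mulmC (ucm _)) !mon_actionM !mon_actionU mixed_lie_swapr.
Qed.

(** Change [i] into [i'] and then [j] into [j']; the remaining cofactors agree by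
cancellation. *)
Lemma mixed_wd i j n i' j' n' : mixed i j n = mixed i' j' n' ->
  act n (mixed_lie i j) = act n' (mixed_lie i' j').
Proof.
move=> e.
have [|n1 e1 ->] := @mixed_changel i i' j n.
  by rewrite e cmM cmUU.
have [|n2 e2 ->] := @mixed_changer i' j j' n1.
  by rewrite -e1 e !cmM cmUU addnCA.
by move: e; rewrite e1 e2 => /cmonom_mulI/cmonom_mulI ->.
Qed.

(** By [mixed_wd] the conditions on [F] never prescribe two values for the same
monomial.  They leave it free on monomials divisible by no [X i * X j]; these lie
outside [M0], so any value will do there. *)
Lemma mixed_eval : exists F : {cmonom (I + J)%type} -> commutant_type L,
  forall i j n, F (mixed i j n) = act n (mixed_lie i j).
Proof.
suff /choice[F FP] m : exists u, forall i j n, m = mixed i j n ->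
    u = act n (mixed_lie i j).
  by exists F => i j n; exact: FP.
have [[i [j [n ->]]]|no] := pselect (exists i j n, m = mixed i j n).
  by exists (act n (mixed_lie i j)) => i' j' n' /mixed_wd.
by exists 0 => i j n e; case: no; exists i, j, n.
Qed.

(** Compatibility with the action cannot be asked outside [M0]: for [p = 1] it
would make every [z i o z j] the multiple by [X i * X j] of one element. *)
Lemma ideal_eval : exists psi : {linear R -> commutant_type L},
  (forall i j, psi (polyvar (inl i) * polyvar (inr j)) = mixed_lie i j) /\
  (forall q p, p \in @M0 k I J -> psi (q * p) = poly_action z q (psi p)).
Proof.
have [F FP] := mixed_eval.
have gen q i j : malg_lift F (q * (polyvar (inl i) * polyvar (inr j)))
    = poly_action z q (mixed_lie i j).
  rewrite malgMU [in LHS](monalgE q) mulr_suml linear_sum.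
  apply: eq_bigr => m _; rewrite malgMU /= malg_liftU; congr (_ *: _).
  by rewrite -FP; congr F; apply/eqP/cmP => v; rewrite !cmM; lia.
have gen1 i j : malg_lift F (polyvar (inl i) * polyvar (inr j)) = mixed_lie i j.
  rewrite -(poly_action1 z (mixed_lie i j)) -gen.
  exact: (congr1 (malg_lift F) (esym (mul1r _))).
exists (malg_lift F); split=> [//|q p pM].
(* Membership in M0 is used through minimality: the p that satisfy the claim
   for every q form an ideal, which contains the generators by gen. *)
pose S : {pred R^o} := fun p => `[< forall q : R,
  malg_lift F (q * p) = poly_action z q (malg_lift F p) >].
suff /asboolP : p \in S by apply.
move: pM => /M0P; apply.
  split=> [|c u v /asboolP uS /asboolP vS]; apply/asboolP => {}q.
    rewrite linear0 (_ : poly_action z q 0 = 0).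
      exact: etrans (congr1 (malg_lift F) (mulr0 q)) (linear0 _).
    by rewrite /poly_action big1 // => m _; rewrite linear0 scaler0.
  rewrite [c *: u + v]/(c * u + v) mulrDr !linearD /= poly_actionDr -vS.
  have H := (equivariant_at_mull (@poly_actionA _ _ _ z) (c : R) uS).
  exact: (congr1 (+%R^~ _) (H q)).
move=> i j; apply/asboolP => {}q.
exact: etrans (gen q i j) (congr1 _ (esym (gen1 i j))).
Qed.

End Presentation.

(** * Comparing the metabelian product with the model *)

Section Product.
Context (k : fieldType) (A B : lieAlgType k).
Context (abelA : abelian_lie A) (abelB : abelian_lie B).
Context (I J : choiceType) (x : I -> A) (y : J -> B).
Context (basisX : is_basis x) (basisY : is_basis y).
Local Notation R := (polyring k (I + J)%type).

Section Coordinates.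
Context (alpha : {linear A -> R}) (beta : {linear B -> R}).
Hypothesis alphaE : forall i, alpha (x i) = polyvar (inl i).
Hypothesis betaE : forall j, beta (y j) = polyvar (inr j).

Lemma coord_mul_M0 a b : alpha a * beta b \in @M0 k I J.
Proof.
have D (p q : R) : p \in @M0 k I J -> q \in @M0 k I J -> p + q \in @M0 k I J.
  exact: (@rpredD _ (@M0 k I J)).
elim/(basis_ind basisX): a => [|c i a IHa].
  by rewrite linear0 mul0r; exact: (@rpred0 _ (@M0 k I J)).
rewrite linearP mulrDl -scalerAl alphaE; apply: (D _ _ _ IHa); apply: M0Z.
elim/(basis_ind basisY): b {IHa} => [|d j b IHb].
  by rewrite linear0 mulr0; exact: (@rpred0 _ (@M0 k I J)).
rewrite linearP mulrDr -scalerAr betaE; apply: (D _ _ _ IHb); apply: M0Z.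
by apply/M0P => S _; exact.
Qed.

Context (P : metabLieType k) (iA : {linear A -> P}) (iB : {linear B -> P}).
Hypothesis (iA_lie : lie_morphism iA) (iB_lie : lie_morphism iB).
Local Notation z := (joint_family iA iB x y).

Lemma poly_action_alpha a u :
  val (poly_action z (alpha a) u) = val u \o_L iA a.
Proof.
elim/(basis_ind basisX): a => [|c i a IHa].
  by rewrite !linear0 poly_action0l lie0r linear0.
rewrite !linearP alphaE poly_actionDl poly_actionZ poly_actionX linearP /=.
by rewrite lieDr lieZr -IHa.
Qed.

Lemma poly_action_beta b u :
  val (poly_action z (beta b) u) = val u \o_L iB b.
Proof.
elim/(basis_ind basisY): b => [|c j b IHb].
  by rewrite !linear0 poly_action0l lie0r linear0.
rewrite !linearP betaE poly_actionDl poly_actionZ poly_actionX linearP /=.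
by rewrite lieDr lieZr -IHb.
Qed.

Section Evaluation.
Context (psi : {linear R -> commutant_type P}).
Hypothesis psi_gen : forall i j,
  psi (polyvar (inl i) * polyvar (inr j)) = mixed_lie z i j.
Hypothesis psiM : forall q p, p \in @M0 k I J ->
  psi (q * p) = poly_action z q (psi p).

Lemma psi_mul_coord a b : val (psi (alpha a * beta b)) = iA a \o_L iB b.
Proof.
elim/(basis_ind basisX): a => [|c i a IHa].
  by rewrite !linear0 mul0r !linear0 lie0l.
rewrite !linearP mulrDl -scalerAl alphaE !linearP /= lieDl lieZl -IHa.
congr (_ *: _ + _).
elim/(basis_ind basisY): b {IHa} => [|d j b IHb].
  by rewrite !linear0 mulr0 !linear0 lie0r.
rewrite !linearP mulrDr -scalerAr betaE !linearP /= lieDr lieZr -IHb.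
exact: (congr1 (fun w => _ *: w + _) (congr1 val (psi_gen i j))).
Qed.

Local Notation Q := (model coord_mul_M0).

Definition model_eval (u : Q) : P :=
  iA (val u).1.1 + iB (val u).1.2 + val (psi (val u).2).

Lemma model_eval_linear : linear model_eval.
Proof.
move=> c u v; rewrite /model_eval (linearP val) /= !linearP /=.
by rewrite !scalerDr [RHS]addrACA [in RHS](addrACA (_ *: iA _)).
Qed.

HB.instance Definition _ :=
  GRing.isLinear.Build k Q P _ model_eval model_eval_linear.

Lemma psi_weight (u v : Q) : val (psi ((val u).2 * weight v))
  = val (psi (val u).2) \o_L (iA (val v).1.1 + iB (val v).1.2).
Proof.
have uM : (val u).2 \in @M0 k I J by exact: (valP u).
rewrite mulrC (psiM _ uM) /weight poly_actionDl linearD /=.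
by rewrite poly_action_alpha poly_action_beta lieDr.
Qed.

(** The three kinds of terms of the bracket match: [alpha a * beta b'] goes to
[iA a \o_L iB b'], multiplication by a weight becomes bracketing with the
corresponding element of [P], and two commutators bracket to [0]. *)
Lemma model_eval_lie (u v : Q) :
  model_eval (u \o_L v) = model_eval u \o_L model_eval v.
Proof.
have -> : model_eval (u \o_L v) = val (psi (model_bracket u v)).
  by rewrite /model_eval /= !linear0 !add0r.
have psiD (p q r s : R) : val (psi (p - q + (r - s)))
    = val (psi p) - val (psi q) + (val (psi r) - val (psi s)).
  by rewrite !linearD !linearN.
apply: etrans (psiD _ _ _ _) _.
apply: etrans (congr2 +%R
  (congr2 (fun p q => p - q) (psi_mul_coord _ _) (psi_mul_coord _ _))
  (congr2 (fun p q => p - q) (psi_weight u v) (psi_weight v u))) _.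
rewrite [RHS]lie_expand //.
- by rewrite -iA_lie abelA linear0.
- by rewrite -iB_lie abelB linear0.
- by apply: commutant_lie0; exact: valP.
Qed.

Section Transfer.
Context (h : {linear P -> Q}).
Hypothesis h_lie : lie_morphism h.
Hypothesis hA : forall a, h (iA a) = model_inl coord_mul_M0 a.
Hypothesis hB : forall b, h (iB b) = model_inr coord_mul_M0 b.
Implicit Types u : commutant_type P.

Lemma transfer_base u : (val (h (val u))).1 = 0.
Proof.
pose S : {pred P} := fun w => `[< (val (h w)).1 = 0 >].
suff /asboolP : val u \in S by [].
move: (valP u) => /commutantP; apply; [split; first split|].
- by apply/asboolP; rewrite !linear0.
- move=> c w w' /asboolP wS /asboolP wS'; apply/asboolP.
  by rewrite linearP (linearP val) /= wS wS' scaler0 addr0.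
- by move=> w a _; apply/asboolP; rewrite h_lie.
- by move=> w a; apply/asboolP; rewrite h_lie.
Qed.

(** [P^2] maps into the ideal [0 x 0 x M0] of the model by [transfer_base]; only
the last component is kept. *)
Definition transfer u : R := (val (h (val u))).2.

Lemma transfer_linear : linear transfer.
Proof. by move=> c u w; rewrite /transfer (linearP val) linearP (linearP val). Qed.

HB.instance Definition _ :=
  GRing.isLinear.Build k (commutant_type P) R _ transfer transfer_linear.

Lemma weight_joint v : weight (h (z v)) = polyvar v.
Proof.
case: v => [i|j] /=.
  by rewrite hA weight_inl alphaE.
by rewrite hB weight_inr betaE.
Qed.

Lemma transfer_lie v u :
  transfer (lie_commutant_r (z v) u) = polyvar v * transfer u.
Proof.
rewrite /transfer /= h_lie -weight_joint mulrC.
exact: model_lie_top (transfer_base u).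
Qed.

Lemma transfer_action p u : transfer (poly_action z p u) = p * transfer u.
Proof.
elim/polyring_ind: p => [|v p IHp|c p q IHp IHq].
- by rewrite poly_action1 mul1r.
- rewrite -poly_actionA poly_actionX transfer_lie.
  exact: etrans (congr1 ( *%R _) IHp) (mulrA _ _ _).
- by rewrite poly_actionDl poly_actionZ linearP /= IHp IHq mulrDl -scalerAl.
Qed.

Lemma transfer_in u : transfer u \in @M0 k I J.
Proof. exact: (valP (h (val u))). Qed.

(** The image is an ideal, and [iA (x i) \o_L iB (y j)] hits the generator
[X i * X j]. *)
Lemma transfer_surj p : p \in @M0 k I J -> exists u, transfer u = p.
Proof.
move=> pM; pose S : {pred R^o} := fun p => `[< exists u, transfer u = p >].
suff /asboolP : p \in S by [].
move: pM => /M0P; apply.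
  split=> [|c q r /asboolP[u uq] /asboolP[w wr]]; apply/asboolP.
    by exists 0; rewrite linear0.
  exists (poly_action z c u + w); rewrite linearD /= transfer_action.
  by rewrite uq wr.
move=> i j; apply/asboolP; exists (mixed_lie z i j).
rewrite /transfer /= h_lie hA hB -alphaE -betaE; exact: model_lie_inl_inr.
Qed.

Definition transfer_M0 (u : commutant_module z) : M0_type k I J :=
  M0Type (transfer_in u).

Lemma transfer_M0_linear : linear transfer_M0.
Proof.
move=> p u w; apply: val_inj; rewrite linearP /=.
exact: etrans (linearD _ _ _) (congr1 (+%R^~ _) (transfer_action p u)).
Qed.

HB.instance Definition _ := GRing.isLinear.Build R (commutant_module z)
  (M0_type k I J) _ transfer_M0 transfer_M0_linear.

Hypothesis endo_unique : forall g : {linear P -> P}, lie_morphism g ->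
  (forall a, g (iA a) = iA a) -> (forall b, g (iB b) = iB b) -> g =1 id.

(** The composite is a Lie endomorphism of [P] that fixes the images of [A] and
[B], so uniqueness forces it to be the identity. *)
Lemma model_evalK w : model_eval (h w) = w.
Proof.
apply: (endo_unique (g := model_eval \o h)) => [u v|a|b] /=.
- by rewrite h_lie; exact: model_eval_lie.
- by rewrite hA /model_eval /= !linear0 !addr0.
- by rewrite hB /model_eval /= !linear0 add0r addr0.
Qed.

Lemma psi_transfer u : psi (transfer u) = u.
Proof.
apply: val_inj; rewrite -[RHS]model_evalK /model_eval transfer_base.
by rewrite !linear0 !add0r.
Qed.

Lemma transfer_M0_bij : bijective transfer_M0.
Proof.
exists (fun p : M0_type k I J => psi (val p)) => [u|p].
  exact: psi_transfer.
apply: val_inj; have [u up] := transfer_surj (valP p).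
by rewrite /= -up psi_transfer.
Qed.

End Transfer.
End Evaluation.
End Coordinates.
End Product.

Theorem theorem2 (k : fieldType) (A B : lieAlgType k)
    (abelA : abelian_lie A) (abelB : abelian_lie B)
    (I J : choiceType) (x : I -> A) (y : J -> B)
    (basisX : is_basis x) (basisY : is_basis y)
    (P : metabLieType k) (iA : {linear A -> P}) (iB : {linear B -> P})
    (prodP : is_metabelian_product iA iB) :
  exists phi : {linear commutant_module (joint_family iA iB x y)
                       -> M0_type k I J},
    bijective phi.
Proof.
have [iA_lie iB_lie univ] := prodP.
have [alpha alphaE] := basis_lift basisX
  (fun i => polyvar (inl i) : polyring k (I + J)%type).
have [beta betaE] := basis_lift basisY
  (fun j => polyvar (inr j) : polyring k (I + J)%type).
have [i i'|j j'|psi [psi_gen psiM]] :=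
  @ideal_eval _ _ _ _ (joint_family iA iB x y).
- by rewrite /= -iA_lie abelA linear0.
- by rewrite /= -iB_lie abelB linear0.
pose ab := coord_mul_M0 basisX basisY alphaE betaE.
have [||h [h_lie hA hB _]] := univ (model ab) (model_inl ab) (model_inr ab).
- by move=> a a'; rewrite abelA linear0 model_inl_lie.
- by move=> b b'; rewrite abelB linear0 model_inr_lie.
have endo_unique (g : {linear P -> P}) : lie_morphism g ->
    (forall a, g (iA a) = iA a) -> (forall b, g (iB b) = iB b) -> g =1 id.
  (* The universal property for the maps iA and iB themselves *)
  have [g0 [_ _ _ g0P]] := univ P iA iB iA_lie iB_lie.
  by move=> g_lie gA gB w; rewrite g0P // -(g0P idfun).
have bij := transfer_M0_bij abelA abelB iA_lie iB_lie psi_gen psiM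
  h_lie hA hB endo_unique.
exact: ex_intro bij.
Qed.
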